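(* Let $\{\boldsymbol{\mu}^q,w_q\}_{q=1}^Q$ be a $Q$-point quadrature rule on $\boldsymbol{\Gamma}$ (the weights $w_q\in\mathbb{R}$ may be negative), let $u^{\mathcal{N}}(\cdot,\boldsymbol{\mu})\in X_{\mathcal{N}}$ be the truth solution and let $u^N(\cdot,\boldsymbol{\mu})$ be an $N$-dimensional reduced basis approximation of it, with weighted a posteriori error estimate $\Delta^w_N(\boldsymbol{\mu}^q)=\Delta_N(\boldsymbol{\mu}^q)\sqrt{Q|w_q|}$, where the a posteriori estimate $\Delta_N$ satisfies $\Delta_N(\boldsymbol{\mu}^q)\ge \|u^{\mathcal{N}}(\cdot,\boldsymbol{\mu}^q)-u^N(\cdot,\boldsymbol{\mu}^q)\|_{X_{\mathcal{N}}}$ for $q=1,\dots,Q$. Then for each $m\in\{1,\dots,M\}$ the gPC coefficients $$\widehat{u}^{\mathcal{N}}_m=\sum_{q=1}^Q w_q\,u^{\mathcal{N}}(\cdot,\boldsymbol{\mu}^q)\,\Phi_m(\boldsymbol{\mu}^q),\qquad \widehat{u}^{N}_m=\sum_{q=1}^Q w_q\,u^{N}(\cdot,\boldsymbol{\mu}^q)\,\Phi_m(\boldsymbol{\mu}^q)$$ satisfy $$\left\|\widehat{u}^{\mathcal{N}}_m-\widehat{u}^{N}_m\right\|_{X_{\mathcal{N}}}\le B_{Q,m}\sqrt{\frac1Q\sum_{q=1}^Q\left(\Delta^w_N(\boldsymbol{\mu}^q)\right)^2},\qquad\text{where } B_{Q,m}=\sqrt{\sum_{q=1}^Q|w_q|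\,\Phi_m^2(\boldsymbol{\mu}^q)}.$$
   Context: Parameters: $\boldsymbol{\mu}=(\mu_1,\dots,\mu_K)$ is a random vector with mutually independent components, $\mu_i$ having image $\Gamma_i\subset\mathbb{R}$, probability density $\rho_i$ and finite moments of all orders; $\boldsymbol{\Gamma}=\Gamma_1\times\cdots\times\Gamma_K$ and $\rho(\boldsymbol{\mu})=\prod_i\rho_i(\mu_i)$. For each $i$, $\{\phi^{(i)}_n\}_{n\ge0}$ are the orthonormal polynomials for $\rho_i$ ($\deg\phi^{(i)}_n=n$), and $\Phi_\alpha(\boldsymbol{\mu})=\prod_{k=1}^K\phi^{(k)}_{\alpha_k}(\mu_k)$ for $\alpha\in\mathbb{N}_0^K$. The functions $\Phi_1,\dots,\Phi_M$, with $M=\binom{K+P}{K}$, enumerate the $\Phi_\alpha$ with $|\alpha|=\sum_k\alpha_k\le P$, in an ordering nondecreasing in $|\alpha|$. The quadrature rule is meant to approximate $\int_{\boldsymbol{\Gamma}}f\rho\,d\boldsymbol{\mu}\approx\sum_q w_q f(\boldsymbol{\mu}^q)$. Truth solution: $X_{\mathcal{N}}$ is a real Hilbert space of dimension $\mathcal{N}$ (a discretized space of functions of the spatial variable $\boldsymbol{x}\in D$) with norm $\|\cdot\|_{X_{\mathcal{N}}}$. For each $\boldsymbol{\mu}\in\boldsymbol{\Gamma}$, $u^{\mathcal{N}}(\cdot,\boldsymbol{\mu})\in X_{\mathcal{N}}$ is the unique solution of a discretized linear PDE $\mathcal{L}^{\mathcal{N}}(\boldsymbol{\mu})u^{\mathcal{N}}(\cdot,\boldsymbol{\mu})=f^{\mathcal{N}}(\boldsymbol{\mu})$,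 with $\mathcal{L}^{\mathcal{N}}(\boldsymbol{\mu})$ an invertible linear operator (identified with its matrix). Reduced basis approximation: given $\boldsymbol{\nu}^1,\dots,\boldsymbol{\nu}^N$ in the training set $\Xi=\{\boldsymbol{\mu}^q\}_{q=1}^Q$, set $X^N=\mathrm{span}\{u^{\mathcal{N}}(\cdot,\boldsymbol{\nu}^k)\}_{k=1}^N\subset X_{\mathcal{N}}$. For each $\boldsymbol{\mu}$, $u^N(\cdot,\boldsymbol{\mu})=\sum_{k=1}^N c_k(\boldsymbol{\mu})u^{\mathcal{N}}(\cdot,\boldsymbol{\nu}^k)\in X^N$, where the real coefficients $c_k(\boldsymbol{\mu})$ are determined by $\mathcal{P}\big[\sum_k c_k(\boldsymbol{\mu})\mathcal{L}^{\mathcal{N}}(\boldsymbol{\mu})u^{\mathcal{N}}(\cdot,\boldsymbol{\nu}^k)\big]=\mathcal{P}[f^{\mathcal{N}}(\boldsymbol{\mu})]$ for a chosen projection operator $\mathcal{P}$ (e.g. least squares). A posteriori estimate: $\Delta_N(\boldsymbol{\mu})=\|R_N(\cdot,\boldsymbol{\mu})\|_{X_{\mathcal{N}}}/\sqrt{\beta_{LB}(\boldsymbol{\mu})}$, where $R_N(\cdot,\boldsymbol{\mu})$ is (the Riesz representation of) the residual $f^{\mathcal{N}}(\boldsymbol{\mu})-\mathcal{L}^{\mathcal{N}}(\boldsymbol{\mu})u^N(\cdot,\boldsymbol{\mu})$ and $0<\beta_{LB}(\boldsymbol{\mu})\le\min_{v\ne0}\frac{v^T\mathcal{L}^{\mathcal{N}}(\boldsymbol{\mu})^T\mathcal{L}^{\mathcal{N}}(\boldsymbol{\mu})v}{\|v\|^2_{X_{\mathcal{N}}}}$.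 The standing assumption is that this estimate is rigorous, i.e. $\Delta_N(\boldsymbol{\mu})\ge\|u^{\mathcal{N}}(\cdot,\boldsymbol{\mu})-u^N(\cdot,\boldsymbol{\mu})\|_{X_{\mathcal{N}}}$ for all $\boldsymbol{\mu}\in\Xi$; this is the only property of $\Delta_N$ that matters for the claim. *)

(* Defs.v *)
From HB Require Import structures.
From mathcomp Require Import all_boot all_order all_algebra.
From mathcomp Require Import all_classical all_reals all_analysis.

Set Implicit Arguments.
Unset Strict Implicit.
Unset Printing Implicit Defensive.

Import Order.TTheory GRing.Theory Num.Theory.
Import numFieldNormedType.Exports.

Local Open Scope classical_set_scope.
Local Open Scope ring_scope.

Section RandomParameters.
Context (R : realType) (d : measure_display) (Omega : measurableType d)
  (Pr : probability Omega R).

Definition mutually_independent (I : finType) (X : I -> {RV Pr >-> R}) : Prop :=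
  forall (J : {set I}) (A : I -> set R), (forall i, measurable (A i)) ->
    Pr (\bigcap_(i in [set` J]) (X i @^-1` A i)) =
    (\prod_(i in J) Pr (X i @^-1` A i))%E.

Definition has_density (X : {RV Pr >-> R}) (rho : R -> R) : Prop :=
  [/\ measurable_fun setT rho,
      forall x, 0 <= rho x &
      forall A, measurable A ->
        distribution Pr X A = (\int[lebesgue_measure]_(x in A) (rho x)%:E)%E].

Definition has_finite_moments (X : {RV Pr >-> R}) : Prop :=
  forall n : nat, Pr.-integrable setT (fun omega => (X omega ^+ n)%:E).

(* The integral runs over the whole line rather than over the image of the
   random variable: that image carries all the mass of rho, but it need not be
   a Borel set. *)
Definition orthonormal_polynomials (rho : R -> R) (phi : nat -> {poly R}) :
    Prop :=
  (forall n, size (phi n) = n.+1) /\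
  (forall m n,
    (\int[lebesgue_measure]_x ((phi m).[x] * (phi n).[x] * rho x)%:E)%E =
    ((m == n)%:R : R)%:E).

Definition parameter_domain (K : nat) (mu : 'I_K -> {RV Pr >-> R}) :
    set 'rV[R]_K :=
  [set p | forall i, range (mu i) (p 0 i)].

End RandomParameters.

Section PolynomialChaos.
Context (R : realType) (K : nat).

Definition total_degree (alpha : {ffun 'I_K -> nat}) : nat :=
  (\sum_k alpha k)%N.

Definition gpc_basis (phi : 'I_K -> nat -> {poly R})
    (alpha : {ffun 'I_K -> nat}) (p : 'rV[R]_K) : R :=
  \prod_k (phi k (alpha k)).[p 0 k].

Definition graded_enumeration (P M : nat) (a : 'I_M -> {ffun 'I_K -> nat}) :
    Prop :=
  [/\ injective a,
      forall alpha, (exists m, a m = alpha) <-> (total_degree alpha <= P)%N &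
      forall m n : 'I_M,
        (m <= n)%N -> (total_degree (a m) <= total_degree (a n))%N].

Definition gpc_coefficient (X : vectType R) (Q : nat) (node : 'I_Q -> 'rV[R]_K)
    (w : 'I_Q -> R) (v : 'rV[R]_K -> X) (Phi : 'rV[R]_K -> R) : X :=
  \sum_q (w q * Phi (node q)) *: v (node q).

Definition gpc_constant (Q : nat) (node : 'I_Q -> 'rV[R]_K) (w : 'I_Q -> R)
    (Phi : 'rV[R]_K -> R) : R :=
  Num.sqrt (\sum_q `|w q| * Phi (node q) ^+ 2).

End PolynomialChaos.

(* A finite-dimensional real Hilbert space is a vectType over R with a
   symmetric positive definite form; completeness is automatic. *)
Definition hnorm (R : realType) (X : vectType R) (ip : {dot X for idfun})
    (v : X) : R :=
  Num.sqrt (ip v v).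

Section ReducedBasis.
Context (R : realType) (K Ncal : nat) (X : vectType R).
Context (ip : {dot X for idfun}) (e : Ncal.-tuple X).
(* L p and f p are the matrix of the discrete operator and the discrete right
   hand side, relative to the coordinates of X in the basis e. *)
Context (L : 'rV[R]_K -> 'M[R]_Ncal) (f : 'rV[R]_K -> 'cV[R]_Ncal).

Definition coords (v : X) : 'cV[R]_Ncal := \col_i coord e i v.

Definition is_truth_solution (Gamma : set 'rV[R]_K) (u : 'rV[R]_K -> X) :
    Prop :=
  forall p, Gamma p ->
    L p \in unitmx /\ forall v : X, L p *m coords v = f p <-> v = u p.

Section Approximation.
Context (N : nat) (u : 'rV[R]_K -> X) (nu : 'I_N -> 'rV[R]_K).

Definition rb_space : {vspace X} := <<[seq u (nu k) | k : 'I_N]>>%VS.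

Definition rb_solution (c : 'rV[R]_K -> 'rV[R]_N) (p : 'rV[R]_K) : X :=
  \sum_k c p 0 k *: u (nu k).

(* The projection may depend on the parameter: least squares is the case where
   proj p is the orthogonal projection onto the span of the images by L p of
   the snapshots. *)
Definition rb_coefficients (Gamma : set 'rV[R]_K)
    (proj : 'rV[R]_K -> 'M[R]_Ncal) (c : 'rV[R]_K -> 'rV[R]_N) : Prop :=
  forall p, Gamma p ->
    proj p *m proj p = proj p /\
    forall x : 'rV[R]_N,
      proj p *m (\sum_k x 0 k *: (L p *m coords (u (nu k)))) = proj p *m f p
      <-> x = c p.

End Approximation.

(* The residual vector acts on X through the coordinates in e, and r p is the
   element of X that represents this functional. *)
Definition is_riesz_residual (Gamma : set 'rV[R]_K) (uN : 'rV[R]_K -> X)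
    (r : 'rV[R]_K -> X) : Prop :=
  forall p, Gamma p -> forall v : X,
    ip (r p) v = ((coords v)^T *m (f p - L p *m coords (uN p))) 0 0.

Definition is_stability_bound (Gamma : set 'rV[R]_K) (beta : 'rV[R]_K -> R) :
    Prop :=
  forall p, Gamma p -> 0 < beta p /\
    forall v : X, v != 0 ->
      beta p <= ((coords v)^T *m (L p)^T *m L p *m coords v) 0 0
                / hnorm ip v ^+ 2.

Definition error_estimate (r : 'rV[R]_K -> X) (beta : 'rV[R]_K -> R)
    (p : 'rV[R]_K) : R :=
  hnorm ip (r p) / Num.sqrt (beta p).

End ReducedBasis.

Definition weighted_estimate (R : realType) (K Q : nat)
    (node : 'I_Q -> 'rV[R]_K) (w : 'I_Q -> R) (Delta : 'rV[R]_K -> R)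
    (q : 'I_Q) : R :=
  Delta (node q) * Num.sqrt (Q%:R * `|w q|).

(* Main.v *)
(* The difference of the coefficients is the sum of the quadrature-node errors
   weighted by w_q Phi_m(mu^q).  The triangle inequality bounds its norm by
   sum_q |w_q| |Phi_m| Delta_N, and splitting |w_q| = sqrt |w_q| * sqrt |w_q|
   between the two factors, Cauchy-Schwarz in R^Q gives the bound; this is how
   negative weights are accommodated. *)
Require Import Defs.
From HB Require Import structures.
From mathcomp Require Import all_boot all_order all_algebra.
From mathcomp Require Import all_classical all_reals all_analysis.
From mathcomp Require Import ring.

Set Implicit Arguments.
Unset Strict Implicit.
Unset Printing Implicit Defensive.

Import Order.TTheory GRing.Theory Num.Theory.
Import numFieldNormedType.Exports.

Local Open Scope classical_set_scope.
Local Open Scope ring_scope.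

Lemma CauchySchwarz_sum (R : rcfType) (I : finType) (F G : I -> R) :
  \sum_i F i * G i
  <= Num.sqrt (\sum_i F i ^+ 2) * Num.sqrt (\sum_i G i ^+ 2).
Proof.
have F2_ge0 : 0 <= \sum_i F i ^+ 2 by apply: sumr_ge0 => i _; exact: sqr_ge0.
rewrite -sqrtrM // (le_trans (ler_norm _)) // -sqrtr_sqr ler_wsqrtr //.
(* The defect is doubled so that it becomes a sum over all ordered pairs; a sum over pairs with i <
   j would need an order on [I]. *)
rewrite -subr_ge0 -(pmulrn_lge0 _ (n := 2)) //.
(* Lagrange's identity *)
suff -> :
    ((\sum_i F i ^+ 2) * (\sum_i G i ^+ 2) - (\sum_i F i * G i) ^+ 2) *+ 2 =
    \sum_i \sum_j (F i * G j - F j * G i) ^+ 2.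
  by apply: sumr_ge0 => i _; apply: sumr_ge0 => j _; exact: sqr_ge0.
(* Of the two copies of the product, one is commuted, so that they supply both squares F_i^2 G_j^2
   and F_j^2 G_i^2 of the (i, j) term. *)
rewrite mulrnBl mulr2n {2}[_ * \sum_i G i ^+ 2]mulrC expr2 !big_distrlr /=.
rewrite -sumrMnl -big_split -sumrB /=; apply: eq_bigr => i _.
rewrite -sumrMnl -big_split -sumrB /=; apply: eq_bigr => j _; ring.
Qed.

Section HilbertNorm.
Variables (R : realType) (X : vectType R) (ip : {dot X for idfun}).

Lemma ip_ge0 (v : X) : 0 <= ip v v.
Proof.
by have [->|/(neq0_dnorm_gt0 (s := ip))/ltW//] := eqVneq v 0; rewrite linear0r.
Qed.

(** For nonzero v, the component of u orthogonal to v, scaled by <v,v> to avoid division, has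
    squared norm <v,v> (<u,u> <v,v> - <u,v>^2). This is nonnegative, and the factor <v,v> > 0 can be
    cancelled. *)
Lemma CauchySchwarz_ip (u v : X) : ip u v ^+ 2 <= ip u u * ip v v.
Proof.
have [->|v_neq0] := eqVneq v 0; first by rewrite !linear0r expr0n.
have := ip_ge0 (ip v v *: u - ip u v *: v).
rewrite hnormB /= mul1r !linearZl_LR !linearZr_LR /= => ge0.
rewrite -subr_ge0 -(pmulr_rge0 _ (neq0_dnorm_gt0 (s := ip) _ v_neq0)).
rewrite (le_trans ge0) // le_eqVlt; apply/orP; left; apply/eqP.
by rewrite /GRing.scale /=; ring.
Qed.

Lemma hnorm_ge0 (v : X) : 0 <= hnorm ip v.
Proof. exact: sqrtr_ge0. Qed.

Lemma sqr_hnorm (v : X) : hnorm ip v ^+ 2 = ip v v.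
Proof. by rewrite sqr_sqrtr // ip_ge0. Qed.

Lemma hnormZ (a : R) (v : X) : hnorm ip (a *: v) = `|a| * hnorm ip v.
Proof.
by rewrite /hnorm linearZl_LR linearZr_LR /= mulrA -expr2 sqrtrM ?sqr_ge0 //
           sqrtr_sqr.
Qed.

Lemma ler_hnormD (u v : X) : hnorm ip (u + v) <= hnorm ip u + hnorm ip v.
Proof.
rewrite -ler_sqr ?nnegrE ?addr_ge0 ?hnorm_ge0 // sqrrD !sqr_hnorm.
rewrite hnormD /= mul1r addrAC -mulr2n lerD2r lerD2l lerMn2r /=.
rewrite (le_trans (ler_norm _)) // -sqrtr_sqr -sqrtrM ?ip_ge0 //.
exact/ler_wsqrtr/CauchySchwarz_ip.
Qed.

Lemma ler_hnorm_sum (I : finType) (F : I -> X) :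
  hnorm ip (\sum_i F i) <= \sum_i hnorm ip (F i).
Proof.
elim/big_ind2 : _ => [|x u y v le_xu le_yv|//].
  by rewrite /hnorm linear0r sqrtr0.
by rewrite (le_trans (ler_hnormD u v)) // lerD.
Qed.

End HilbertNorm.

Lemma gpc_coefficientB (R : realType) (K : nat) (X : vectType R) (Q : nat)
    (node : 'I_Q -> 'rV[R]_K) (w : 'I_Q -> R) (u v : 'rV[R]_K -> X)
    (Phi : 'rV[R]_K -> R) :
  gpc_coefficient node w u Phi - gpc_coefficient node w v Phi =
  \sum_q (w q * Phi (node q)) *: (u (node q) - v (node q)).
Proof. by rewrite -sumrB; apply: eq_bigr => q _; rewrite scalerBr. Qed.

(** The factor [Q] under the root in the weighted estimate cancels the averaging, which leaves the
    second sum of squares of the Cauchy-Schwarz step. *)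
Lemma mean_sqr_weighted_estimate (R : realType) (K Q : nat)
    (node : 'I_Q -> 'rV[R]_K) (w : 'I_Q -> R) (Delta : 'rV[R]_K -> R) :
  (0 < Q)%N ->
  Q%:R^-1 * \sum_q weighted_estimate node w Delta q ^+ 2 =
  \sum_q `|w q| * Delta (node q) ^+ 2.
Proof.
move=> Q_gt0; rewrite mulr_sumr; apply: eq_bigr => q _.
rewrite exprMn sqr_sqrtr ?mulr_ge0 // mulrCA mulKf 1?mulrC //.
by rewrite pnatr_eq0 -lt0n.
Qed.

Theorem lemma2
  (R : realType)
  (d : measure_display) (Omega : measurableType d) (Pr : probability Omega R)
  (K : nat) (mu : 'I_K -> {RV Pr >-> R}) (rho : 'I_K -> R -> R)
  (mu_indep : mutually_independent mu)
  (mu_density : forall i, has_density (mu i) (rho i))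
  (mu_moments : forall i, has_finite_moments (mu i))
  (phi : 'I_K -> nat -> {poly R})
  (phi_orth : forall i, orthonormal_polynomials (rho i) (phi i))
  (P : nat) (a : 'I_('C(K + P, K)) -> {ffun 'I_K -> nat})
  (a_enum : graded_enumeration P a)
  (Q : nat) (Q_gt0 : (0 < Q)%N) (node : 'I_Q -> 'rV[R]_K) (w : 'I_Q -> R)
  (node_dom : forall q, parameter_domain mu (node q))
  (Ncal : nat) (X : vectType R) (ip : {dot X for idfun})
  (e : Ncal.-tuple X) (e_basis : basis_of fullv e)
  (L : 'rV[R]_K -> 'M[R]_Ncal) (f : 'rV[R]_K -> 'cV[R]_Ncal)
  (u : 'rV[R]_K -> X)
  (u_truth : is_truth_solution e L f (parameter_domain mu) u)
  (N : nat) (nu : 'I_N -> 'rV[R]_K)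
  (nu_training : forall k, range node (nu k))
  (rb_dim : \dim (rb_space u nu) = N)
  (proj : 'rV[R]_K -> 'M[R]_Ncal) (c : 'rV[R]_K -> 'rV[R]_N)
  (c_rb : rb_coefficients e L f u nu (parameter_domain mu) proj c)
  (r : 'rV[R]_K -> X) (beta : 'rV[R]_K -> R)
  (r_riesz : is_riesz_residual ip e L f (parameter_domain mu)
               (rb_solution u nu c) r)
  (beta_lb : is_stability_bound ip e L (parameter_domain mu) beta)
  (Delta_rigorous : forall q : 'I_Q,
     hnorm ip (u (node q) - rb_solution u nu c (node q))
     <= error_estimate ip r beta (node q))
  (m : 'I_('C(K + P, K))) :
  let Phi_m := gpc_basis phi (a m) in
  let u_m := gpc_coefficient node w u Phi_m in
  let uN_m := gpc_coefficient node w (rb_solution u nu c) Phi_m in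
  let Delta_w := weighted_estimate node w (error_estimate ip r beta) in
  hnorm ip (u_m - uN_m)
  <= gpc_constant node w Phi_m
     * Num.sqrt (Q%:R^-1 * \sum_q Delta_w q ^+ 2).
Proof.
cbv zeta; set Phi := gpc_basis phi (a m).
rewrite gpc_coefficientB mean_sqr_weighted_estimate //.
apply: le_trans (ler_hnorm_sum _ _) _.
set Delta := error_estimate ip r beta in Delta_rigorous *.
have sqr_split x q : (Num.sqrt `|w q| * x) ^+ 2 = `|w q| * x ^+ 2.
  by rewrite exprMn sqr_sqrtr.
rewrite /gpc_constant -(eq_bigr _ (fun q _ => sqr_split (Delta (node q)) q)).
(* [Phi] is replaced by its absolute value before the root is absorbed: the triangle inequality
   produces |Phi|, and the products in [CauchySchwarz_sum] carry no absolute values. *)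
under [X in _ <= Num.sqrt X * _]eq_bigr => q _ do
  rewrite -real_normK ?num_real // -sqr_split.
apply: le_trans (CauchySchwarz_sum _ _); apply: ler_sum => q _.
(* The two roots recombine into |w_q|, so both sides share the factor |w_q| |Phi| and only the
   rigour of the estimate at the node remains. *)
rewrite hnormZ normrM mulrACA -expr2 sqr_sqrtr // mulrA.
by rewrite ler_wpM2l ?mulr_ge0 ?Delta_rigorous.
Qed.
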